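(* Let $G = G_1 \times \cdots \times G_k$ be a direct product of finite groups (not necessarily abelian), let $D$ be a nonempty fractional factorial design on $G$ with counting function $O : G \to \mathbb{Z}_{\ge 0}$, and assume that $O$ is a class function on $G$. For each $\chi \in \mathrm{Irr}(G)$ let $$\chi(D) = \sum_{\mathbf{x} \in G} O(\mathbf{x}) \overline{\chi(\mathbf{x})}, \qquad \mu_\chi = \langle O, \chi\rangle = \frac{1}{|G|}\sum_{\mathbf{x}\in G} O(\mathbf{x})\overline{\chi(\mathbf{x})},$$ and for $j = 1,\ldots,k$ let $$A_j(D) = N^{-2} \sum_{\chi \in \mathrm{Irr}(G),\ \mathrm{wt}(\chi) = j} |\chi(D)|^2, \qquad N = |D| = \sum_{\mathbf{x}\in G} O(\mathbf{x}).$$ Let $t$ be an integer with $1 \le t \le k$. Then the following are equivalent: 1. $D$ has strength $t$. 2. $A_1(D) = \cdots = A_t(D) = 0$. 3. $\mu_\chi = 0$ for all $\chi \in \mathrm{Irr}(G)$ with $1 \le \mathrm{wt}(\chi) \le t$.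
   Context: All groups are finite; characters are complex-valued; $\mathrm{Irr}(G)$ is the set of irreducible characters of $G$. A class function on $G$ is a function $G \to \mathbb{C}$ constant on conjugacy classes. A fractional factorial design $D$ on $G = G_1\times\cdots\times G_k$ is a multisubset of $G$: each element $\mathbf{x}\in G$ occurs with some multiplicity $O(\mathbf{x}) \in \mathbb{Z}_{\ge 0}$, and $O$ is called the counting function of $D$. Strength: for indices $i_1 < \cdots < i_m$ in $\{1,\ldots,k\}$, let $H = G_{i_1}\times\cdots\times G_{i_m}$ and $p : G \to H$, $p(x_1,\ldots,x_k) = (x_{i_1},\ldots,x_{i_m})$. The projection of $D$ on factors $i_1,\ldots,i_m$ is the multisubset of $H$ with counting function $O'(\mathbf{y}) = \sum_{p(\mathbf{x}) = \mathbf{y}} O(\mathbf{x})$. The design $D$ has strength $t \ge 1$ if the projection of $D$ onto any $t$ factors has constant counting function (the constant may depend on the choice of the $t$ factors). Factorial subgroups: for $I \subseteq \{1,\ldots,k\}$, the product $\prod_{i\in I} G_i$ is identified with the subgroup of $G$ consisting of all $\mathbf{x}$ with $x_i$ equal to the identity of $G_i$ for $i \notin I$. Such a subgroup is called a factorial subgroup of $G$, its rank is $|I|$, and its factorial complement is $\prod_{i\notin I} G_i$ (factorial subgroups are specified by their index sets $I$; $I=\emptyset$ is allowed). Weight of a character: $\ker(\chi) = \{g \in G : \chi(g) = \chi(e)\}$, where $e$ is the identity of $G$. For $\chi\in\mathrm{Irr}(G)$, let $K$ be the largest factorial subgroup contained in $\ker(\chi)$ (largest index set). The base of $\chi$, $\mathrm{base}(\chi)$,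 is the factorial complement of $K$ in $G$, and $\mathrm{wt}(\chi) = \mathrm{rank}(\mathrm{base}(\chi))$. *)

(* Defs.v *)
From HB Require Import structures.
From mathcomp Require Import all_boot all_order all_algebra all_fingroup.
From mathcomp Require Import all_solvable all_field all_character.

Set Implicit Arguments.
Unset Strict Implicit.
Unset Printing Implicit Defensive.

Import Order.TTheory GRing.Theory Num.Theory.
Local Open Scope ring_scope.

(* The direct product G_1 x ... x G_k, with the componentwise group law of
   gproduct.v. *)
Notation dirprod gT := {dffun forall i, gT i}.

Section FactorialDesigns.

Variables (k : nat) (gT : 'I_k -> finGroupType).

Implicit Types (O : dirprod gT -> nat) (I J : {set 'I_k}).

Local Notation G := [set: dirprod gT].

Definition design_size O : nat := (\sum_x O x)%N.

Definition class_counting O : Prop := forall x y, O (x ^ y)%g = O x.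

Definition subproduct J : finType :=
  {dffun forall i : {i : 'I_k | i \in J}, gT (val i)}.

Definition proj J (x : dirprod gT) : subproduct J := [ffun i => x (val i)].

Definition proj_count O J (y : subproduct J) : nat :=
  (\sum_(x | proj J x == y) O x)%N.

Definition has_strength O (t : nat) : Prop :=
  forall J, #|J| = t -> exists c : nat, forall y, proj_count O (J := J) y = c.

Definition factorial_subgroup I : {group dirprod gT} :=
  setXn_group (fun i => if i \in I then [set: gT i]%G else 1%G).

(* For an irreducible chi, cfker chi is [set g | chi g == chi 1]
   (lemma cfkerEirr). *)
Definition ker_factors (chi : 'CF(G)) : {set 'I_k} :=
  [arg max_(I > set0 | factorial_subgroup I \subset cfker chi) #|I|].

Lemma mem_factorial_subgroup I (x : dirprod gT) :
  reflect (forall i, i \notin I -> x i = 1%g) (x \in factorial_subgroup I).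
Proof.
apply: (iffP setXnP) => xI i; first by move=> iI; have := xI i;
  rewrite (negbTE iI) => /set1P.
by case: ifP => [_|/negbT iI]; [rewrite inE | rewrite xI ?inE].
Qed.

(* The maximum in ker_factors is also the maximum for inclusion; this fixes the
   index set uniquely even when some of the gT i are trivial. *)
Lemma ker_factorsP (chi : 'CF(G)) I :
  (factorial_subgroup I \subset cfker chi) = (I \subset ker_factors chi).
Proof.
have mono (A B : {set 'I_k}) : A \subset B -> factorial_subgroup A \subset factorial_subgroup B.
  move=> sAB; apply/subsetP=> x /mem_factorial_subgroup xA.
  apply/mem_factorial_subgroup=> i iB; apply: xA.
  by apply: contra iB; apply: (subsetP sAB).
rewrite /ker_factors; case: arg_maxnP => [|K sK maxK].
  apply/subsetP=> x /mem_factorial_subgroup x1.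
  suff -> : x = 1%g by apply: group1.
  by apply/ffunP=> i; rewrite x1 ?inE // oneg_ffun.
apply/idP/idP=> [sI|/mono sIK]; last exact: subset_trans sK.
have sU : factorial_subgroup (I :|: K) \subset cfker chi.
  apply/subsetP=> x /mem_factorial_subgroup xU.
  pose y : dirprod gT := [ffun i => if i \in I then x i else 1%g].
  rewrite -[x](mulKVg y) groupM //.
    apply: (subsetP sI); apply/mem_factorial_subgroup=> i iI.
    by rewrite ffunE (negbTE iI).
  apply: (subsetP sK); apply/mem_factorial_subgroup=> i iK.
  rewrite mulg_ffun invg_ffun ffunE; case: ifP => [_|/negbT iI].
    by rewrite mulVg.
  by rewrite invg1 mul1g xU // !inE negb_or iI.
have /eqP -> : K == I :|: K by rewrite eqEcard subsetUr; exact: maxK sU.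
exact: subsetUl.
Qed.

(* The base is specified by its index set. *)
Definition base_factors (chi : 'CF(G)) : {set 'I_k} := ~: ker_factors chi.

Definition wt (chi : 'CF(G)) : nat := #|base_factors chi|.

Definition char_sum O (chi : 'CF(G)) : algC :=
  \sum_x (O x)%:R * (chi x)^*.

Definition mu O (chi : 'CF(G)) : algC := #|G|%:R^-1 * char_sum O chi.

Definition wordlength O (j : nat) : algC :=
  (design_size O)%:R ^- 2 *
    \sum_(i : Iirr G | wt 'chi_i == j) `|char_sum O 'chi_i| ^+ 2.

End FactorialDesigns.

(* Main.v *)
Require Import Defs.
From HB Require Import structures.
From mathcomp Require Import all_boot all_order all_algebra all_fingroup.
From mathcomp Require Import all_solvable all_field all_character.

Set Implicit Arguments.
Unset Strict Implicit.
Unset Printing Implicit Defensive.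

Import Order.TTheory GRing.Theory Num.Theory.
Local Open Scope ring_scope.

(** The equivalence of the last two conditions is positivity: [wordlength O j]
    is a positive multiple of a sum of squared moduli, one for each irreducible
    character of weight [j], and [mu O chi] is a positive multiple of
    [char_sum O chi].

    For the strength, fix an index set [J] of size [t] and let [K] be the
    factorial subgroup on [~: J]. The fibres of [proj J] are the cosets of [K]
    ([eq_proj]), and [K] lies in the kernel of [chi] exactly when the base of
    [chi] is contained in [J]. The projected counting function, pulled back to
    the whole group as [F x = proj_count O (proj J x)], is invariant under [K],
    and against a character trivial on [K] it has the same sum as [O], up to the
    factor [#|K|] ([sum_proj_count]).

    If the design has strength [t] and [1 <= wt chi <= t], choose [J] containing
    the base of [chi]. Then [F] is constant, and [chi], being nonprincipal, is
    orthogonal to constants; hence [char_sum O chi = 0].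

    Conversely, suppose that these sums vanish. As [O] is a class function, so is
    [F], and being [K]-invariant it is lifted from the quotient by [K]. It is
    therefore a combination of irreducible characters trivial on [K]; these have
    weight at most [t], and only the principal one has weight [0], so every other
    coefficient vanishes and [F] is constant ([const_of_orth_irr]). *)

Lemma sum_conj_irr (gT : finGroupType) (G : {group gT}) (i : Iirr G) :
  i != 0 -> \sum_(x in G) ('chi_i x)^* = 0.
Proof.
move=> nz_i; have := cfdot_irr 0 i; rewrite eq_sym (negPf nz_i) cfdotE => /eqP.
rewrite mulf_eq0 invr_eq0 pnatr_eq0 eqn0Ngt cardG_gt0 /= => /eqP sum0; rewrite -[RHS]sum0.
by apply: eq_bigr => x Gx; rewrite irr0 cfun1E Gx mul1r.
Qed.

Lemma exists_cfun (gT : finGroupType) (f : gT -> algC) :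
  (forall x y, f (x ^ y)%g = f x) -> exists phi : 'CF([set: gT]), phi =1 f.
Proof.
move=> fJ; have f_class : is_class_fun <<[set: gT]>>%g [ffun x => f x].
  rewrite genGid; apply: intro_class_fun => [x y _ _ | x]; first exact: fJ.
  by rewrite in_setT.
by exists (Cfun 0 f_class) => x; rewrite cfunE.
Qed.

(** A class function with [K] in its kernel is lifted from [G / K], so only
    irreducible characters trivial on [K] occur in its Fourier expansion: it is
    enough to test orthogonality against those. *)
Lemma const_of_orth_irr (gT : finGroupType) (G K : {group gT}) (phi : 'CF(G)) :
    (K <| G)%g -> K \subset cfker phi ->
    (forall i : Iirr G, i != 0 -> K \subset cfker 'chi_i ->
       '[phi, 'chi_i] = 0) ->
  phi = '[phi, 'chi_0] *: 1.
Proof.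
move=> nKG kerK orth; rewrite -{1}(cfQuoK nKG kerK).
rewrite {1}[(phi / K)%CF]cfun_sum_cfdot (bigD1 0) //= big1 => [|i nz_i].
  by rewrite addr0 linearZ -(cfMod_iso nKG) (cfQuoK nKG kerK) /= !irr0 cfMod_cfun1.
have := orth (mod_Iirr i); rewrite mod_Iirr_eq0 // mod_IirrE // cfker_mod //.
move=> /(_ nz_i isT).
by rewrite -{1}(cfQuoK nKG kerK) cfMod_iso // => ->; rewrite scale0r.
Qed.

Lemma exists_superset (T : finType) (A : {set T}) (n : nat) :
  (#|A| <= n <= #|T|)%N -> exists2 B : {set T}, A \subset B & #|B| = n.
Proof.
elim: n => [|n IHn] /andP[leAn lenT].
  by exists A => //; apply/eqP; rewrite -leqn0.
move: leAn; rewrite leq_eqVlt => /predU1P[<- | ltAn]; first by exists A.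
have [|B sAB cardB] := IHn; first by rewrite -ltnS ltAn ltnW.
have [x xB]: exists x, x \in ~: B.
  by apply/card_gt0P; rewrite cardsCs setCK cardB subn_gt0.
exists (x |: B); first exact: subset_trans sAB (subsetUr _ _).
by rewrite cardsU1 -in_setC xB cardB.
Qed.

Section Projections.

Variables (k : nat) (gT : 'I_k -> finGroupType).
Implicit Types (O : dirprod gT -> nat) (I J : {set 'I_k}) (x y : dirprod gT).

Local Notation G := [set: dirprod gT].

Lemma eq_proj J x y :
  (proj J x == proj J y) = ((x^-1 * y)%g \in factorial_subgroup gT (~: J)).
Proof.
apply/eqP/mem_factorial_subgroup=> [/ffunP eq_xy i | xy1].
  rewrite inE negbK => Ji; have := eq_xy (Sub i Ji); rewrite !ffunE /= => eqi.
  by rewrite eqi mulVg.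
apply/ffunP=> -[i Ji]; rewrite !ffunE /=; have := xy1 i.
rewrite inE negbK mulg_ffun invg_ffun => /(_ Ji) xyi.
by rewrite -[RHS](mulKVg (x i)) xyi mulg1.
Qed.

Lemma proj_surj J (z : subproduct gT J) : exists x, proj J x = z.
Proof.
pose lift i : gT i := if decP (@idP (i \in J)) is left Ji
                      then z (exist _ i Ji) else 1%g.
exists [ffun i => lift i]; apply/ffunP=> -[i Ji]; rewrite !ffunE /lift /=.
by case: (decP idP) => // Ji'; rewrite (bool_irrelevance Ji' Ji).
Qed.

Lemma factorial_subgroup_normal I : (factorial_subgroup gT I <| G)%g.
Proof.
rewrite /normal subsetT; apply/subsetP=> x _; rewrite inE.
apply/subsetP=> _ /imsetP[z /mem_factorial_subgroup z1 ->].
apply/mem_factorial_subgroup=> i Ii.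
by rewrite conjgE !mulg_ffun invg_ffun z1 // mul1g mulVg.
Qed.

Lemma sub_cfker_base (chi : 'CF(G)) J :
  (factorial_subgroup gT (~: J) \subset cfker chi) = (base_factors chi \subset J).
Proof. by rewrite ker_factorsP -setCS setCK. Qed.

(** Weight [0] means that the kernel is the whole group, which among irreducible
    characters leaves only the principal one. *)
Lemma wt_irr_eq0 (i : Iirr G) : (wt 'chi_i == 0) = (i == 0).
Proof.
rewrite cards_eq0 -subset0 -sub_cfker_base setC0 -subGcfker.
suff -> : factorial_subgroup gT setT = G :> {set _} by [].
apply/setP=> x; rewrite in_setT.
by apply/mem_factorial_subgroup=> i'; rewrite inE.
Qed.

(** Summing over the fibres of [proj J], that is, over cosets of a subgroup on
    which [chi] is trivial, counts each term of [char_sum O chi] once for each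
    element of that subgroup. *)
Lemma sum_proj_count O J (chi : 'CF(G)) :
    factorial_subgroup gT (~: J) \subset cfker chi ->
  \sum_x (proj_count O (proj J x))%:R * (chi x)^* =
    #|factorial_subgroup gT (~: J)|%:R * char_sum O chi.
Proof.
set K := factorial_subgroup gT _ => kerK.
transitivity (\sum_x \sum_(y | proj J y == proj J x)
                (O y)%:R * (chi y)^*).
  apply: eq_bigr => x _; rewrite natr_sum mulr_suml; apply: eq_bigr => y.
  rewrite eq_proj => Kyx; congr (_ * (_)^*).
  by rewrite -[x in LHS](mulKVg y) cfkerMr // (subsetP kerK).
(* Each y now contributes once for every x in its fibre. *)
rewrite (exchange_big_dep predT) //= mulr_sumr; apply: eq_bigr => y _.
rewrite sumr_const -[LHS]mulr_natl; congr (_%:R * _).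
rewrite -(card_imset _ (mulgI y^-1%g)); apply: eq_card => z.
apply/imsetP/idP=> [[x xy ->] | Kz]; first by rewrite -eq_proj.
have yz : proj J y == proj J (y * z)%g by rewrite eq_proj mulKg.
by exists (y * z)%g; [exact: yz | rewrite mulKg].
Qed.

(** Conjugation permutes the fibres of [proj J], as they are the cosets of a
    normal subgroup. *)
Lemma proj_count_class O J : class_counting O ->
  forall x y, proj_count O (proj J (x ^ y)%g) = proj_count O (proj J x).
Proof.
move=> classO x y; rewrite /proj_count (reindex_inj (conjg_inj y)) /=.
apply: eq_big => z; last by rewrite classO.
rewrite !eq_proj -conjVg -conjMg memJ_norm //.
exact: (subsetP (normal_norm (factorial_subgroup_normal _))).
Qed.

Section Characterizations.

Variables (O : dirprod gT -> nat) (t : nat).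

Lemma mu_eq0 (chi : 'CF(G)) : (mu O chi == 0) = (char_sum O chi == 0).
Proof. by rewrite mulf_eq0 invr_eq0 pnatr_eq0 eqn0Ngt cardG_gt0. Qed.

Lemma wordlength_eq0P (j : nat) : (0 < design_size O)%N ->
  wordlength O j = 0 <->
    (forall i : Iirr G, wt 'chi_i = j -> mu O 'chi_i = 0).
Proof.
move=> O_gt0; rewrite /wordlength; split=> [/eqP | mu0].
  rewrite mulf_eq0 invr_eq0 expf_eq0 pnatr_eq0 eqn0Ngt O_gt0 /= => /eqP sum0 i.
  move=> wt_i; apply/eqP; rewrite mu_eq0 -normr_eq0 -sqrf_eq0; apply/eqP.
  by apply: (psumr_eq0P _ sum0) => [i' _|]; rewrite ?exprn_ge0 ?wt_i.
rewrite big1 ?mulr0 // => i /eqP /mu0 /eqP; rewrite mu_eq0 => /eqP ->.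
by rewrite normr0 expr0n.
Qed.

Lemma strength_mu_eq0 : (t <= k)%N -> has_strength O t ->
  forall i : Iirr G, (1 <= wt 'chi_i <= t)%N -> mu O 'chi_i = 0.
Proof.
move=> le_tk strO i /andP[wt_gt0 wt_le].
have nz_i : i != 0 by rewrite -wt_irr_eq0 -lt0n.
have [|J sBJ cardJ] := @exists_superset _ (base_factors 'chi_i) t.
  by rewrite wt_le card_ord.
have [c cP] := strO J cardJ; apply/eqP; rewrite mu_eq0.
have := @sum_proj_count O J 'chi_i; rewrite sub_cfker_base => /(_ sBJ) /esym/eqP.
under eq_bigr do rewrite cP.
have sum0 : \sum_x ('chi_i x)^* = 0.
  by rewrite -[RHS](sum_conj_irr nz_i); apply: eq_bigl => x; rewrite in_setT.
rewrite -mulr_sumr sum0 mulr0 mulf_eq0 pnatr_eq0.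
by rewrite eqn0Ngt cardG_gt0.
Qed.

Lemma mu_eq0_strength : class_counting O ->
    (forall i : Iirr G, (1 <= wt 'chi_i <= t)%N -> mu O 'chi_i = 0) ->
  has_strength O t.
Proof.
move=> classO mu0 J cardJ; exists (proj_count O (proj J 1%g)) => z.
have [x <-{z}] := proj_surj z.
set K := factorial_subgroup gT (~: J).
pose f x : algC := (proj_count O (proj J x))%:R.
have [y z|phi phiE] := @exists_cfun _ f; first by rewrite /f proj_count_class.
have kerK : K \subset cfker phi.
  apply/subsetP=> y Ky; rewrite !inE /=; apply/forallP=> z.
  rewrite !phiE /f; suff /eqP -> : proj J (y * z)%g == proj J z by [].
  rewrite eq_sym eq_proj -[(z^-1 * _)%g]/(y ^ z)%g memJ_norm //.
  exact: (subsetP (normal_norm (factorial_subgroup_normal _))).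
have orth (i : Iirr G) : i != 0 -> K \subset cfker 'chi_i -> '[phi, 'chi_i] = 0.
  move=> nz_i kerKi; have wt_i : (1 <= wt 'chi_i <= t)%N.
    by rewrite lt0n wt_irr_eq0 nz_i -cardJ subset_leq_card // -sub_cfker_base.
  have /eqP := mu0 i wt_i; rewrite mu_eq0 => /eqP sum0.
  rewrite cfdotE; under eq_bigl do rewrite in_setT.
  under eq_bigr do rewrite phiE /f.
  by rewrite sum_proj_count // sum0 !mulr0.
have phi_const := const_of_orth_irr (factorial_subgroup_normal _) kerK orth.
apply/eqP; rewrite -(eqr_nat algC) -![_%:R]/(f _) -!phiE.
by rewrite phi_const !cfunE !cfun1E !inE.
Qed.

End Characterizations.

End Projections.

Theorem theorem4p3 (k : nat) (gT : 'I_k -> finGroupType)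
    (O : dirprod gT -> nat) (t : nat)
    (O_nonempty : (0 < design_size O)%N)
    (O_class : class_counting O)
    (ht : (1 <= t <= k)%N) :
  (has_strength O t <->
     (forall j : nat, (1 <= j <= t)%N -> wordlength O j = 0)) /\
  ((forall j : nat, (1 <= j <= t)%N -> wordlength O j = 0) <->
     (forall i : Iirr [set: dirprod gT],
        (1 <= wt 'chi_i <= t)%N -> mu O 'chi_i = 0)).
Proof.
have [_ le_tk] := andP ht.
have wordlength_mu :
  (forall j : nat, (1 <= j <= t)%N -> wordlength O j = 0) <->
  (forall i : Iirr [set: dirprod gT],
     (1 <= wt 'chi_i <= t)%N -> mu O 'chi_i = 0).
  split=> [A0 i wt_i | mu0 j j_t].
    by have /(wordlength_eq0P _ O_nonempty) := A0 _ wt_i; apply.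
  by apply/(wordlength_eq0P _ O_nonempty) => i wt_i; apply: mu0; rewrite wt_i.
split=> //; split=> [strO | A0].
  by apply/wordlength_mu; apply: strength_mu_eq0.
by apply: mu_eq0_strength => //; apply/wordlength_mu.
Qed.
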